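(* Let $(X,\mathcal{T}_X)$ be an overt Spreen space and $(Y,\mathcal{T}_Y)$ a (pointwise) regular space. Then every map $f : X \to Y$ is pointwise continuous.
   Context: We work constructively, in higher-order intuitionistic logic with Dependent Choice, so Countable Choice also holds. $\Sigma$ denotes the Rosolini dominance $\Sigma=\{p\in\Omega \mid \exists f\in 2^{\mathbb{N}}\,(p\Leftrightarrow \exists n\in\mathbb{N}\, f(n)=1)\}$, where $\Omega$ is the set of truth values; its elements are the semidecidable truth values. For a set $X$, elements of $\Sigma^X$ (maps $X\to\Sigma$, identified with subsets of $X$) are the semidecidable subsets of $X$. A space $(X,\mathcal{T})$ is a set $X$ together with a Malcev topology: a subset $\mathcal{T}\subseteq\Sigma^X$ closed under finite intersections (including $X$) and countable unions. Its members are called open. A subset $T\subseteq X$ is overt if for every $\phi:X\to\Sigma$ the truth value $\exists x\in T\,\phi(x)$ is semidecidable. A space is overt if $X$ is overt as a subset of itself. A space $(X,\mathcal{T})$ is a Spreen space if for every overt $T\subseteq X$, every semidecidable $S\in\Sigma^X$ with $S\cap T=\emptyset$, and every $x\in S$, there is $U\in\mathcal{T}$ with $x\in U$ and $U\cap T=\emptyset$. A space $(Y,\mathcal{T})$ is (pointwise) regular if for every $y\in V\in\mathcal{T}$ there are disjoint $S,T\in\mathcal{T}$ with $y\in S\subseteq V$ and $T\cup V=Y$. A subset $U$ of a space is pointwise open if for every $x\in U$ there is an open $W$ with $x\in W\subseteq U$. A map is pointwise continuous if inverse images of pointwise open sets are pointwise open. *)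

(* Defs.v *)
(* Rosolini dominance: semidecidable truth values. *)
Definition Sigma (p : Prop) : Prop :=
  exists f : nat -> bool, (p <-> exists n : nat, f n = true).

Definition semidec {X : Type} (S : X -> Prop) : Prop := forall x, Sigma (S x).

Definition malcev_topology {X : Type} (T : (X -> Prop) -> Prop) : Prop :=
  (forall U, T U -> semidec U) /\
  T (fun _ => True) /\
  (forall U V, T U -> T V -> T (fun x => U x /\ V x)) /\
  (forall U : nat -> X -> Prop, (forall n, T (U n)) -> T (fun x => exists n, U n x)).

Record space := Space {
  carrier :> Type;
  opens : (carrier -> Prop) -> Prop;
  opens_malcev : malcev_topology opens
}.

Definition overt_subset {X : Type} (T : X -> Prop) : Prop :=
  forall phi : X -> Prop, semidec phi -> Sigma (exists x, T x /\ phi x).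

Definition overt_space (X : space) : Prop := overt_subset (fun _ : X => True).

Definition spreen (X : space) : Prop :=
  forall T : X -> Prop, overt_subset T ->
  forall S : X -> Prop, semidec S -> (forall x, S x -> T x -> False) ->
  forall x, S x ->
  exists U, opens X U /\ U x /\ (forall y, U y -> T y -> False).

Definition regular_space (Y : space) : Prop :=
  forall (y : Y) (V : Y -> Prop), opens Y V -> V y ->
  exists S T : Y -> Prop, opens Y S /\ opens Y T /\
    (forall z, S z -> T z -> False) /\
    S y /\ (forall z, S z -> V z) /\ (forall z, T z \/ V z).

Definition pointwise_open (X : space) (U : X -> Prop) : Prop :=
  forall x, U x -> exists W, opens X W /\ W x /\ (forall z, W z -> U z).

Definition pointwise_continuous (X Y : space) (f : X -> Y) : Prop :=
  forall U : Y -> Prop, pointwise_open Y U -> pointwise_open X (fun x => U (f x)).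

(* Main.v *)
(* Regularity of Y turns the open neighbourhood W of f x into a pair of disjoint opens
   S and T with f x in S and T covering the complement of W. Every subset of
   Y that is open is semidecidable, and preimages of semidecidable subsets under an
   arbitrary map are semidecidable, so f^-1 S and f^-1 T are semidecidable; since X is
   overt, the semidecidable subset f^-1 T is overt. The Spreen property then yields an
   open neighbourhood of x missing f^-1 T, which therefore lies inside f^-1 W. *)

Require Import Defs.
From Stdlib Require Import Cantor Bool.

Lemma Sigma_and (p q : Prop) : Sigma p -> Sigma q -> Sigma (p /\ q).
Proof.
  intros [f Hf] [g Hg].
  exists (fun n => let (a, b) := Cantor.of_nat n in f a && g b).
  split.
  - intros [hp hq].
    destruct (proj1 Hf hp) as [a Ha], (proj1 Hg hq) as [b Hb].
    exists (Cantor.to_nat (a, b)).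
    now rewrite Cantor.cancel_of_to, Ha, Hb.
  - intros [n Hn].
    destruct (Cantor.of_nat n) as [a b].
    apply andb_prop in Hn as [Ha Hb].
    split; [apply Hf | apply Hg]; eauto.
Qed.

Lemma semidec_and {X : Type} (S T : X -> Prop) :
  semidec S -> semidec T -> semidec (fun x => S x /\ T x).
Proof. intros HS HT x. exact (Sigma_and _ _ (HS x) (HT x)). Qed.

Lemma semidec_preimage {X Y : Type} (f : X -> Y) (S : Y -> Prop) :
  semidec S -> semidec (fun x => S (f x)).
Proof. intros HS x. exact (HS (f x)). Qed.

Lemma semidec_open (Y : space) (U : Y -> Prop) : opens Y U -> semidec U.
Proof. destruct (opens_malcev Y) as [Hsd _]. exact (Hsd U). Qed.

Lemma overt_space_semidec_subset (X : space) (T : X -> Prop) :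
  overt_space X -> semidec T -> overt_subset T.
Proof.
  intros hX HT phi Hphi.
  destruct (hX _ (semidec_and T phi HT Hphi)) as [g Hg].
  exists g. rewrite <- Hg. firstorder.
Qed.

Lemma overt_spreen_separation (X : space) (S T : X -> Prop) (x : X) :
  overt_space X -> spreen X -> semidec S -> semidec T ->
  (forall z, S z -> T z -> False) -> S x ->
  exists U, opens X U /\ U x /\ (forall z, U z -> T z -> False).
Proof.
  intros hXovert hXspreen HS HT Hdis Hx.
  exact (hXspreen T (overt_space_semidec_subset X T hXovert HT) S HS Hdis x Hx).
Qed.

Theorem theorem3p17 (X Y : space) (hXovert : overt_space X) (hXspreen : spreen X)
  (hYreg : regular_space Y) (f : X -> Y) :
  pointwise_continuous X Y f.
Proof.
  intros U HU x Hx.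
  destruct (HU (f x) Hx) as [W [HW [HWx HWU]]].
  destruct (hYreg (f x) W HW HWx) as [S [T [HS [HT [Hdis [HSx [_ HTW]]]]]]].
  destruct (overt_spreen_separation X (fun z => S (f z)) (fun z => T (f z)) x
              hXovert hXspreen
              (semidec_preimage f S (semidec_open Y S HS))
              (semidec_preimage f T (semidec_open Y T HT))
              (fun z => Hdis (f z)) HSx)
    as [V [HV [HVx HVT]]].
  exists V. split; [exact HV | split; [exact HVx |]].
  intros z Hz. apply HWU.
  destruct (HTW (f z)) as [HTz | HWz]; [exfalso; exact (HVT z Hz HTz) | exact HWz].
Qed.
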